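(* For all sufficiently large $n$ there is a graph $G$ on $n$ vertices and a labelling $\ell$ of its vertices such that the Tseitin formula for $(G,\ell)$ requires depth $\Omega(n)$ to refute in Semantic Cutting Planes.
   Context: For a graph $G=(V,E)$ and $\ell:V\to\{0,1\}$, the Tseitin formula of $(G,\ell)$ has a variable $x_e$ for each edge and, for each vertex $v$, the equation $\bigoplus_{u: uv\in E}x_{uv}=\ell(v)$, written as a CNF (clauses ruling out each falsifying assignment) and encoded by linear inequalities in the standard way. Semantic Cutting Planes ($\mathsf{sCP}$): a proof is a sequence of linear inequalities (halfspaces), each either an input inequality or deduced from at most two earlier ones $a_jx\ge c_j$, $a_kx\ge c_k$ by the semantic rule: $a_ix\ge c_i$ may be deduced if every $\{0,1\}$ assignment satisfying both $a_jx\ge c_j$ and $a_kx\ge c_k$ also satisfies $a_ix\ge c_i$. A refutation derives an unsatisfiable inequality (e.g. $0\ge1$). The depth of a proof is the length of the longest path in its proof DAG; the depth to refute $F$ is the minimum depth of an $\mathsf{sCP}$ refutation of $F$. *)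

(* Defs.v *)
From HB Require Import structures.
From mathcomp Require Import all_boot all_order all_algebra.

Set Implicit Arguments.
Unset Strict Implicit.
Unset Printing Implicit Defensive.

Import Order.TTheory GRing.Theory Num.Theory.
Local Open Scope ring_scope.

(* CNF formulas over a finite set X of variables. The literal (x, true) is x
   and (x, false) is its negation. *)

Definition clause (X : finType) := {set X * bool}.
Definition cnf (X : finType) := {set clause X}.

(* Linear inequalities  sum_x coef x * x >= bound. *)

Record ineq (R : realFieldType) (X : finType) := Ineq {
  coef : X -> R;
  bound : R
}.

Definition holds (R : realFieldType) (X : finType)
    (a : {ffun X -> bool}) (h : ineq R X) : bool :=
  bound h <= \sum_x coef h x * (a x)%:R.

(* sum_(x in C) x + sum_(~x in C) (1 - x) >= 1, with the constants collected
   on the right-hand side. *)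
Definition clause_ineq (R : realFieldType) (X : finType) (C : clause X) :
    ineq R X :=
  Ineq (fun x => ((x, true) \in C)%:R - ((x, false) \in C)%:R)
       (1 - #|[set x | (x, false) \in C]|%:R).

(* x >= 0 and - x >= - 1 *)
Definition ge0_ineq (R : realFieldType) (X : finType) (x : X) : ineq R X :=
  Ineq (fun y => (y == x)%:R) 0.
Definition le1_ineq (R : realFieldType) (X : finType) (x : X) : ineq R X :=
  Ineq (fun y => - (y == x)%:R) (- 1).

Definition cnf_input (R : realFieldType) (X : finType) (F : cnf X)
    (h : ineq R X) : Prop :=
  (exists2 C, C \in F & h = clause_ineq R C)
  \/ (exists x, h = ge0_ineq R x \/ h = le1_ineq R x).

(* The i-th line of a proof is deduced from the lines in prem i, or is an input
   inequality with no premises. A {0,1}-tautology may be deduced from no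
   premises. *)
Record scp_proof (R : realFieldType) (X : finType) (F : cnf X) := ScpProof {
  plength : nat;
  line : 'I_plength -> ineq R X;
  prem : 'I_plength -> {set 'I_plength};
  prem_earlier : forall i j, j \in prem i -> (j < i)%N;
  prem_le2 : forall i, (#|prem i| <= 2)%N;
  line_valid : forall i,
    (prem i = set0 /\ cnf_input F (line i))
    \/ (forall a : {ffun X -> bool},
          (forall j, j \in prem i -> holds a (line j)) -> holds a (line i))
}.

(* The number of edges of a longest path j_0 -> ... -> j_k in the DAG with an
   edge from each premise to the line deduced from it. Indices increase along a
   path, so that the bound k < plength P loses nothing. *)
Definition depth (R : realFieldType) (X : finType) (F : cnf X)
    (P : scp_proof R F) : nat :=
  \max_(k < plength P
        | [exists j, exists p : k.-tuple 'I_(plength P),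
             path (fun i i' => i \in prem i') j p]) k.

Definition refutation (R : realFieldType) (X : finType) (F : cnf X)
    (P : scp_proof R F) : Prop :=
  exists i, forall a, ~~ holds a (line (s := P) i).

(* d is the minimum depth of a refutation of F; in particular F is refutable. *)
Definition is_refutation_depth (R : realFieldType) (X : finType) (F : cnf X)
    (d : nat) : Prop :=
  (exists2 P : scp_proof R F, refutation P & depth P = d)
  /\ (forall P : scp_proof R F, refutation P -> (d <= depth P)%N).

Record sgraph := SGraph {
  vertex :> finType;
  adj : rel vertex;
  adj_sym : symmetric adj;
  adj_irr : irreflexive adj
}.

Definition edges (G : sgraph) : {set {set G}} :=
  [set e | [exists u, exists v, adj u v && (e == [set u; v])]].

Notation edge G := {e : {set vertex G} | e \in edges G}.

Definition parity (G : sgraph) (a : {ffun edge G -> bool}) (v : G) : bool :=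
  \big[addb/false]_(e : edge G | v \in val e) a e.

(* The clause on the edges at v that is falsified exactly by the assignments
   agreeing with a on these edges. *)
Definition vertex_clause (G : sgraph) (v : G) (a : {ffun edge G -> bool}) :
    clause (edge G) :=
  [set (e, ~~ a e) | e : edge G & v \in val e].

Definition tseitin (G : sgraph) (l : G -> bool) : cnf (edge G) :=
  \bigcup_v [set vertex_clause v a | a : {ffun edge G -> bool} & parity a v != l v].

(* Main.v *)
(* On the complete graph, walk from the contradiction towards the inputs, keeping
   a partial assignment such that the current line is violated at the point that
   is 1/2 on the unassigned edges. Such a line is violated by at least half of
   the cube, so one of its premises is violated by at least a quarter of it. Assign
   O(n) of the heaviest edges, at most n/16 at each vertex, to make the premise as
   violated as possible. As there are only n^2 edges, the other coefficients have
   l2 norm smaller than the l1 norm of the assigned ones, and this at least doubles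
   the violated fraction, up to a small loss (Chebyshev). Doing it twice brings the
   fraction above 1/2, hence the premise is violated at the midpoint. A vertex that
   has lost too many edges is removed: its remaining edges are assigned with the
   right parity, which costs nothing at the midpoint as long as there are two of
   them. For a small multiple of n steps few vertices are removed, all others keep
   two unassigned edges, and the midpoint satisfies all input inequalities. *)

Require Import Defs.
From mathcomp Require Import all_boot all_order all_algebra.
From mathcomp Require Import boolp reals.
From mathcomp Require Import zify ring lra.

Set Implicit Arguments.
Unset Strict Implicit.
Unset Printing Implicit Defensive.

Import Order.TTheory GRing.Theory Num.Theory.
Local Open Scope ring_scope.

(** * Halfspaces on the cube *)

Section Cube.
Variables (R : realFieldType) (E : finType).
Implicit Types (F T : {set E}) (r x : {ffun E -> bool}) (h : ineq R E).

Definition overlay F r x : {ffun E -> bool} :=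
  [ffun e => if e \in F then x e else r e].

Definition midpoint F r h : R :=
  \sum_e coef h e * (if e \in F then 2^-1 else (r e)%:R).

Definition dev F h x : R := \sum_(e in F) coef h e * ((x e)%:R - 2^-1).

Definition falsified F r h : {set {ffun E -> bool}} :=
  [set x | ~~ holds (overlay F r x) h].

Definition flip T x : {ffun E -> bool} := [ffun e => (e \in T) (+) x e].

Definition minimize T h r : {ffun E -> bool} :=
  [ffun e => if e \in T then coef h e < 0 else r e].

Definition l1 T h : R := \sum_(e in T) `|coef h e|.

Definition cube_size : nat := #|{ffun E -> bool}|.

Lemma flipK T : involutive (flip T).
Proof. by move=> x; apply/ffunP => e; rewrite !ffunE addKb. Qed.

Lemma in_falsified F r h x :
  (x \in falsified F r h) = (midpoint F r h + dev F h x < bound h).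
Proof.
rewrite inE /holds -ltNge; congr (_ < _).
rewrite /midpoint /dev [X in _ + X]big_mkcond -big_split /=.
apply: eq_bigr => e _; rewrite ffunE; case: ifP => _; ring.
Qed.

Lemma dev_flipT F h x : dev F h (flip [set: E] x) = - dev F h x.
Proof.
rewrite /dev -sumrN; apply: eq_bigr => e _; rewrite ffunE in_setT.
by case: (x e) => /=; field.
Qed.

Lemma in_preflip T (A : {set {ffun E -> bool}}) x :
  (x \in flip T @^-1: A) = (flip T x \in A).
Proof. by rewrite inE. Qed.

Lemma card_flip T (A : {set {ffun E -> bool}}) :
  #|flip T @^-1: A| = #|A|.
Proof.
rewrite -(card_imset _ (inv_inj (flipK T))); apply: eq_card => x.
apply/imsetP/idP => [[y]|xA]; first by rewrite inE => yA ->.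
by exists (flip T x); rewrite ?inE flipK.
Qed.

Lemma midpoint_falsified F r h :
  midpoint F r h < bound h -> (cube_size <= 2 * #|falsified F r h|)%N.
Proof.
move=> lt_half; rewrite mul2n -addnn -{2}(card_flip [set: E]).
rewrite -cardsUI (leq_trans _ (leq_addr _ _)) //.
suff -> : falsified F r h :|: flip [set: E] @^-1: falsified F r h = setT.
  by rewrite cardsT.
apply/setP => x; rewrite in_setU in_setT in_preflip.
rewrite !in_falsified dev_flipT; apply/orP.
by have [dev0|dev0] := leP (dev F h x) 0; [left|right]; lra.
Qed.

Lemma falsified_midpoint F r h :
  (cube_size < 2 * #|falsified F r h|)%N -> midpoint F r h < bound h.
Proof.
rewrite mul2n -addnn -{2}(card_flip [set: E]) -cardsUI => lt_card.
have : (0 < #|falsified F r h :&: flip [set: E] @^-1: falsified F r h|)%N.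
  rewrite -(ltn_add2l #|falsified F r h :|: flip [set: E] @^-1: falsified F r h|).
  by rewrite addn0; apply: leq_ltn_trans lt_card; apply: max_card.
case/card_gt0P => x; rewrite in_setI => /andP[].
by rewrite in_preflip !in_falsified dev_flipT; lra.
Qed.

Lemma sum_signs (e f : E) :
  \sum_(x : {ffun E -> bool}) ((x e)%:R - 2^-1) * ((x f)%:R - 2^-1)
  = (e == f)%:R * cube_size%:R / 4 :> R.
Proof.
have [<-|ne_ef] := eqVneq e f.
  transitivity (\sum_(x : {ffun E -> bool}) 4^-1 : R).
    by apply: eq_bigr => x _; case: (x e) => /=; field.
  by rewrite sumr_const mul1r mulr_natl.
set S := LHS; suff : S = - S by rewrite !mul0r; lra.
rewrite {1}/S (reindex_inj (inv_inj (flipK [set e]))) -sumrN.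
apply: eq_bigr => x _; rewrite !ffunE !inE eqxx eq_sym (negPf ne_ef).
by case: (x e) => /=; field.
Qed.

Lemma sum_dev_sqr F h :
  \sum_x dev F h x ^+ 2 = cube_size%:R / 4 * \sum_(e in F) coef h e ^+ 2.
Proof.
under eq_bigr do rewrite expr2 /dev big_distrlr /=.
rewrite exchange_big mulr_sumr /=; apply: eq_bigr => e eF.
rewrite exchange_big (bigD1 e) //= [X in _ + X]big1 => [|f /andP[_ ne_fe]].
  under eq_bigr do rewrite mulrACA.
  by rewrite -mulr_sumr sum_signs eqxx mul1r addr0; ring.
under eq_bigr do rewrite mulrACA.
by rewrite -mulr_sumr sum_signs eq_sym (negPf ne_fe) !mul0r mulr0.
Qed.

(* Chebyshev's inequality *)
Lemma card_dev_lt F h (w d : R) :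
  0 <= w -> 0 <= d -> \sum_(e in F) coef h e ^+ 2 <= d * w ^+ 2 ->
  #|[set x | dev F h x < - (w / 2)]|%:R <= d * cube_size%:R.
Proof.
set A := [set x | _] => w_ge0 d_ge0 le_sum.
have le_A : #|A|%:R * (w ^+ 2 / 4) <= d * cube_size%:R * (w ^+ 2 / 4).
  rewrite mulr_natl -sumr_const.
  have -> : d * cube_size%:R * (w ^+ 2 / 4) = cube_size%:R / 4 * (d * w ^+ 2).
    by ring.
  apply: le_trans (_ : cube_size%:R / 4 * \sum_(e in F) coef h e ^+ 2 <= _).
    rewrite -sum_dev_sqr [leRHS](bigID (mem A)) /=.
    rewrite -[leLHS]addr0 lerD ?sumr_ge0 // => [|x _]; last exact: sqr_ge0.
    by apply: ler_sum => x; rewrite inE => ltx; nra.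
  by rewrite ler_wpM2l // divr_ge0.
have [w_gt0|w_le0] := ltP 0 w.
  by rewrite -(ler_pM2r (_ : 0 < w ^+ 2 / 4)) // divr_gt0 ?exprn_gt0.
have w0 : w = 0 by lra.
move: le_sum; rewrite w0 expr0n mulr0 => sum_le0.
have coef0 e : e \in F -> coef h e = 0.
  move=> eF; apply/eqP; rewrite -sqrf_eq0; apply/eqP.
  apply: (psumr_eq0P (P := mem F) (F := fun e => coef h e ^+ 2)) => // [i _|].
    exact: sqr_ge0.
  by apply/eqP; rewrite eq_le sum_le0 sumr_ge0 // => i _; apply: sqr_ge0.
suff -> : A = set0 by rewrite cards0 mulr_ge0.
apply/setP => x; rewrite !inE w0 mul0r oppr0 /dev big1 ?ltxx // => e eF.
by rewrite coef0 ?mul0r.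
Qed.

Lemma overlay_minimize F T r h x :
  T \subset F ->
  midpoint F r h + dev F h x = midpoint (F :\: T) (minimize T h r) h
    + dev (F :\: T) h x + \sum_(e in T) `|coef h e| * ((coef h e < 0) (+) x e)%:R.
Proof.
move=> /subsetP sTF; rewrite /midpoint /dev [\sum_(e in F) _]big_mkcond.
rewrite [\sum_(e in F :\: T) _]big_mkcond [\sum_(e in T) _]big_mkcond.
rewrite -!big_split /=.
apply: eq_bigr => e _; rewrite !ffunE !inE.
have := sTF e; case: (e \in T) => /= [->//|_]; last by case: (e \in F); ring.
by case: (ltP (coef h e) 0) => [/ltr0_norm->|/ger0_norm->]; case: (x e) => /=; field.
Qed.

Lemma midpoint_minimize F T r h :
  T \subset F ->
  midpoint (F :\: T) (minimize T h r) h = midpoint F r h - l1 T h / 2.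
Proof.
move=> /subsetP sTF.
rewrite /midpoint /l1 mulr_suml [\sum_(e in T) _]big_mkcond -sumrB /=.
apply: eq_bigr => e _; rewrite !ffunE !inE.
have := sTF e; case: (e \in T) => /= [->//|_]; last by rewrite subr0.
by case: (ltP (coef h e) 0) => [/ltr0_norm->|/ger0_norm->] /=; field.
Qed.

(* Pair each point with its flip on T. One of the two exceeds the minimum over
   the T-coordinates by at least half of the l1 norm, which is more than the
   remaining coordinates can usually compensate. *)
Lemma minimize_boost F T r h (d : R) :
  0 <= d -> T \subset F ->
  \sum_(e in F :\: T) coef h e ^+ 2 <= d * l1 T h ^+ 2 ->
  let r' := minimize T h r in
  midpoint (F :\: T) r' h < bound h \/
  2 * #|falsified F r h|%:R
    <= #|falsified (F :\: T) r' h|%:R + d * cube_size%:R.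
Proof.
move=> d_ge0 sTF le_sum r'.
have [?|half_ge] := ltP (midpoint (F :\: T) r' h) (bound h); [by left|right].
have l1_ge0 : 0 <= l1 T h by apply: sumr_ge0.
have le_dev := card_dev_lt l1_ge0 d_ge0 le_sum.
rewrite -(lerD2l #|falsified (F :\: T) r' h|%:R) in le_dev.
apply: le_trans le_dev.
rewrite -natrM -natrD ler_nat mul2n -addnn -{2}(card_flip T) -cardsUI.
apply: leq_add; apply: subset_leq_card; apply/subsetP => x.
  rewrite in_setU in_preflip !in_falsified.
  rewrite !(overlay_minimize _ _ _ sTF) -/r'.
  have -> : dev (F :\: T) h (flip T x) = dev (F :\: T) h x.
    by apply: eq_bigr => e; rewrite inE ffunE => /andP[/negPf->].
  set Z := \sum_(e in T) _; set Z' := \sum_(e in T) _.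
  have : 0 <= Z by apply: sumr_ge0 => e _; rewrite mulr_ge0.
  have : 0 <= Z' by apply: sumr_ge0 => e _; rewrite mulr_ge0.
  by move=> ? ? /orP[]; lra.
rewrite in_setI in_preflip !in_falsified in_set.
rewrite !(overlay_minimize _ _ _ sTF) -/r'.
have -> : dev (F :\: T) h (flip T x) = dev (F :\: T) h x.
  by apply: eq_bigr => e; rewrite inE ffunE => /andP[/negPf->].
have : \sum_(e in T) `|coef h e| * ((coef h e < 0) (+) x e)%:R
     + \sum_(e in T) `|coef h e| * ((coef h e < 0) (+) flip T x e)%:R = l1 T h.
  rewrite -big_split; apply: eq_bigr => e eT; rewrite /= ffunE eT.
  by case: (x e); case: (coef h e < 0) => /=; ring.
by move=> ? /andP[]; lra.
Qed.

Lemma boost2 F T1 T2 r h :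
  T1 \subset F -> T2 \subset F :\: T1 ->
  \sum_(e in F :\: T1) coef h e ^+ 2 <= 7^-1 * l1 T1 h ^+ 2 ->
  \sum_(e in F :\: T1 :\: T2) coef h e ^+ 2 <= 7^-1 * l1 T2 h ^+ 2 ->
  (cube_size <= 4 * #|falsified F r h|)%N ->
  midpoint (F :\: T1 :\: T2) (minimize T2 h (minimize T1 h r)) h < bound h.
Proof.
move=> sT1 sT2 le1 le2 lecard.
have d_ge0 : 0 <= 7^-1 :> R by rewrite invr_ge0.
have l1_ge0 : 0 <= l1 T2 h by apply: sumr_ge0.
have [lt1|boost1] := minimize_boost r d_ge0 sT1 le1.
  by rewrite midpoint_minimize //; lra.
have [//|boost] := minimize_boost (minimize T1 h r) d_ge0 sT2 le2.
apply: falsified_midpoint; rewrite -(ltr_nat R) natrM.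
have cube_gt0 : 0 < cube_size%:R :> R.
  by rewrite ltr0n; apply/card_gt0P; exists [ffun=> false].
move: lecard; rewrite -(ler_nat R) natrM.
by lra.
Qed.

(* One edge e0 of smaller weight is used to meet a parity constraint; another
   edge of at least this weight is set to its minimizing value and makes up
   for the loss. *)
Lemma midpoint_set_parity F (S A : {set E}) r h (b : bool) :
  S \subset F -> S \subset A -> (2 <= #|S|)%N ->
  exists r', [/\ forall e, e \notin S -> r' e = r e,
    \big[addb/false]_(e in A) r' e = b & midpoint (F :\: S) r' h <= midpoint F r h].
Proof.
move=> sSF sSA.
suff: forall e0 e1, e0 \in S -> e1 \in S -> e0 != e1 ->
    `|coef h e0| <= `|coef h e1| ->
  exists r', [/\ forall e, e \notin S -> r' e = r e,
    \big[addb/false]_(e in A) r' e = b & midpoint (F :\: S) r' h <= midpoint F r h].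
  move=> wlog_le /card_gt1P[e0 [e1 [e0S e1S ne]]].
  have [le01|/ltW le10] := leP `|coef h e0| `|coef h e1|.
    exact: (wlog_le e0 e1).
  by apply: (wlog_le e1 e0) => //; rewrite eq_sym.
move=> e0 e1 e0S e1S ne le01.
set m := minimize S h r.
set c := \big[addb/false]_(e in A | e != e0) m e.
exists [ffun e => if e == e0 then b (+) c else m e]; split.
- move=> e eS; rewrite !ffunE; case: eqP eS => [->|_]; first by rewrite e0S.
  by move/negPf->.
- rewrite (bigD1 e0) ?(subsetP sSA) //= ffunE eqxx.
  rewrite (eq_bigr (fun e => m e)) -/c ?addbK // => e /andP[_ /negPf].
  by rewrite ffunE => ->.
apply: le_trans (_ : midpoint (F :\: S) m h + `|coef h e0| <= _).
  rewrite /midpoint (bigD1 e0) //= [X in _ <= X + _](bigD1 e0) //= !inE e0S /=.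
  rewrite ffunE eqxx.
  rewrite (eq_bigr (fun e => coef h e * (if e \in F :\: S then 2^-1 else (m e)%:R))).
    rewrite addrAC lerD2r ffunE e0S.
    by case: (ltP (coef h e0) 0) => [/[dup]? /ltr0_norm->|/[dup]? /ger0_norm->];
      case: (b (+) c) => /=; lra.
  by move=> e /negPf ne_e; rewrite ffunE ne_e.
rewrite midpoint_minimize // /l1 (bigD1 e0) //= (bigD1 e1) /=; last by rewrite e1S eq_sym.
have : 0 <= \sum_(e | (e \in S) && (e != e0) && (e != e1)) `|coef h e| by apply: sumr_ge0.
by lra.
Qed.

End Cube.

(** * Choosing heavy edges of bounded degree *)

Section Selection.
Variables (R : realFieldType) (E V : finType) (inc : E -> {set V}).
Variable w : E -> R.
Hypothesis w_ge0 : forall e, 0 <= w e.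
Implicit Types (F T A G : {set E}) (v : V).

Definition star T v : {set E} := [set e in T | v \in inc e].

Definition weight A : R := \sum_(e in A) w e.

Lemma weight_ge0 A : 0 <= weight A.
Proof. exact: sumr_ge0. Qed.

Lemma light_subset A (D : nat) : (0 < D)%N -> (#|A| <= D)%N ->
  exists G, [/\ G \subset A, (#|A :\: G| < D)%N & weight G <= weight A / D%:R].
Proof.
move=> D_gt0 leAD; have [ltAD|geAD] := ltnP #|A| D.
  exists set0; rewrite sub0set setD0; split=> //.
  by rewrite /weight big_set0 divr_ge0 // weight_ge0.
have : (0 < #|A|)%N by apply: leq_trans geAD.
case/card_gt0P => a0 a0A.
case: (arg_minP w a0A) => a aA le_a; exists [set a]; split.
- by rewrite sub1set.
- by move: leAD; rewrite (cardsD1 a A) [a \in A]aA.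
rewrite /weight big_set1 ler_pdivlMr ?ltr0n // mulr_natr.
apply: (@le_trans _ _ (w a *+ #|A|)); first by rewrite ler_wpMn2l.
by rewrite -sumr_const; apply: ler_sum.
Qed.

Lemma select F (N D : nat) : (0 < N)%N -> (0 < D)%N ->
  exists T, [/\ T \subset F, (#|T| <= N)%N, forall v, (#|star T v| <= D)%N &
    forall e, e \in F :\: T ->
      w e <= \sum_(v in inc e) weight (star T v) / D%:R + weight T / N%:R].
Proof.
move=> N_gt0 D_gt0.
pose feasible T := [&& T \subset F, #|T| <= N & [forall v, #|star T v| <= D]]%N.
have feas0 : feasible set0.
  rewrite /feasible sub0set cards0 /=; apply/forallP => v.
  by rewrite (_ : star _ _ = set0) ?cards0 //; apply/setP => e; rewrite !inE.
case: (arg_maxP weight feas0) => T /and3P[sTF leTN /forallP leTD] max_T.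
exists T; split => // e /setDP[eF eT].
have [g g_light] := fin_all_exists (fun v => light_subset D_gt0 (leTD v)).
have [g0 [sg0 ltg0 leg0]] := light_subset N_gt0 leTN.
pose G := g0 :|: \bigcup_(v in inc e) g v.
have feas : feasible (e |: T :\: G).
  apply/and3P; split.
  - by rewrite subUset sub1set eF (subset_trans (subsetDl _ _)).
  - rewrite cardsU1 inE (negPf eT) andbF add1n (leq_ltn_trans _ ltg0) //.
    by rewrite subset_leq_card // setDS // subsetUl.
  apply/forallP => v; have [sgv ltgv _] := g_light v.
  have [ve|ve] := boolP (v \in inc e).
    apply: leq_trans ltgv; rewrite -add1n.
    apply: leq_trans (_ : #|e |: (star T v :\: g v)| <= _)%N; last first.
      by rewrite cardsU1; case: (_ \notin _).
    apply: subset_leq_card; apply/subsetP => f; rewrite !inE.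
    case: eqP => //= _ /andP[/andP[/norP[_ fG] ->] ->]; rewrite !andbT.
    by apply: contra fG => fg; apply/bigcupP; exists v.
  apply: leq_trans (leTD v); apply: subset_leq_card; apply/subsetP => f.
  rewrite !inE; case: eqP => [->|_] /=; first by rewrite (negPf ve).
  by case/andP => /andP[_ ->] ->.
have := max_T _ feas; rewrite /weight big_setU1 ?inE ?(negPf eT) ?andbF //=.
rewrite -/(weight T) -/(weight (T :\: G)) => le_we.
have : weight T <= weight (T :\: G) + weight g0 + \sum_(v in inc e) weight (g v).
  rewrite /weight (exchange_big_dep xpredT) //= 3![\sum_(_ in _) _]big_mkcond.
  rewrite -!big_split /=; apply: ler_sum => f _; rewrite !inE negb_or.
  have sum_ge0 : 0 <= \sum_(v in inc e | f \in g v) w f by apply: sumr_ge0.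
  have [fT|fT] := boolP (f \in T); last first.
    by rewrite andbF; case: ifP => _; have := w_ge0 f; lra.
  rewrite andbT; have [fg0|fg0] /= := boolP (f \in g0); first by have := w_ge0 f; lra.
  have [/bigcupP[v ve fg]|_] /= := boolP (f \in \bigcup_(v in inc e) g v); last lra.
  rewrite (bigD1 v) ?ve //= !add0r lerDl; exact: sumr_ge0.
have : \sum_(v in inc e) weight (g v) <= \sum_(v in inc e) weight (star T v) / D%:R.
  by apply: ler_sum => v _; case: (g_light v).
rewrite -/(weight T) in leg0 *; lra.
Qed.

Hypothesis card_inc : forall e, #|inc e| = 2%N.
Variable n : nat.
Hypothesis deg_le : forall v, (#|star setT v| <= n)%N.
Hypothesis card_E : (#|E| <= n * n)%N.

Lemma sum_weight_star T : \sum_v weight (star T v) = 2 * weight T.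
Proof.
rewrite /weight mulr_sumr (exchange_big_dep (mem T)) /= => [|v e _]; last first.
  by rewrite inE => /andP[].
apply: eq_bigr => e eT; rewrite -[2]/(2%:R) -(card_inc e) mulr_natl -sumr_const.
by apply: eq_bigl => v; rewrite inE eT.
Qed.

Lemma select_l2 F (D : nat) : (2200 <= D)%N -> (0 < n)%N -> (n <= 17 * D)%N ->
  exists T, [/\ T \subset F, (#|T| <= 8 * n)%N, forall v, (#|star T v| <= D)%N &
    \sum_(e in F :\: T) w e ^+ 2 <= 7^-1 * weight T ^+ 2].
Proof.
move=> D_ge n_gt0 le_nD.
have [||T [sTF leN leD le_w]] := @select F (8 * n) D; [lia|lia|].
exists T; split=> //.
set b := weight T / (8 * n)%N%:R; set a := fun v => weight (star T v) / D%:R.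
have n_gt0R : 0 < n%:R :> R by rewrite ltr0n.
have D_gt0R : 2200 <= D%:R :> R by rewrite (ler_nat _ 2200).
have le_nDR : n%:R <= 17 * D%:R :> R by rewrite -natrM ler_nat.
have le_sq e : e \in F :\: T -> w e ^+ 2 <= 3 * (\sum_(v in inc e) a v ^+ 2 + b ^+ 2).
  move=> eFT; have := le_w _ eFT; rewrite -/b.
  have /eqP/cards2P[u [v [ne_uv ->]]] := card_inc e.
  rewrite !big_setU1 ?inE //= !big_set1 -/(a u) -/(a v) => le_we.
  apply: le_trans (_ : (a u + a v + b) ^+ 2 <= _).
    by rewrite ler_sqr ?nnegrE //; have := w_ge0 e; lra.
  have := sqr_ge0 (a u - a v); have := sqr_ge0 (a u - b); have := sqr_ge0 (a v - b).
  by lra.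
have sum_a2 : \sum_v a v ^+ 2 <= 4 * weight T ^+ 2 / D%:R ^+ 2.
  under eq_bigr do rewrite expr_div_n.
  rewrite -mulr_suml ler_wpM2r ?invr_ge0 ?sqr_ge0 //.
  apply: le_trans (_ : (\sum_v weight (star T v)) ^+ 2 <= _).
    rewrite [leRHS]expr2 mulr_suml; apply: ler_sum => v _; rewrite expr2.
    rewrite ler_wpM2l ?weight_ge0 // (bigD1 v) //= lerDl sumr_ge0 // => u _.
    exact: weight_ge0.
  by rewrite sum_weight_star; lra.
apply: le_trans (_ : 3 * (n%:R * (4 * weight T ^+ 2 / D%:R ^+ 2)
                          + (n * n)%:R * b ^+ 2) <= _).
  apply: le_trans (_ : \sum_e 3 * (\sum_(v in inc e) a v ^+ 2 + b ^+ 2) <= _).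
    rewrite [leRHS](bigID (mem (F :\: T))) /= -[leLHS]addr0 lerD ?ler_sum //.
    apply: sumr_ge0 => e _; rewrite mulr_ge0 // addr_ge0 ?sqr_ge0 ?sumr_ge0 // => v _.
    exact: sqr_ge0.
  rewrite -mulr_sumr ler_wpM2l // big_split /= sumr_const lerD //; last first.
    by rewrite -[leLHS]mulr_natl ler_wpM2r ?sqr_ge0 // ler_nat.
  apply: le_trans (_ : n%:R * (\sum_v a v ^+ 2) <= _); last by rewrite ler_wpM2l.
  rewrite (exchange_big_dep xpredT) //= mulr_sumr; apply: ler_sum => v _.
  rewrite sumr_const -[leLHS]mulr_natl ler_wpM2r ?sqr_ge0 // ler_nat.
  apply: leq_trans (deg_le v); apply: subset_leq_card.
  by apply/subsetP => e; rewrite !inE.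
rewrite /b !natrM; have := sqr_ge0 (weight T); set W := weight T ^+ 2 => W_ge0.
have -> : 3 * (n%:R * (4 * W / D%:R ^+ 2) + n%:R * n%:R * (weight T / (8 * n%:R)) ^+ 2)
   = (12 * (n%:R / D%:R ^+ 2) + 3 / 64) * W :> R.
  by rewrite /W; field; rewrite !lt0r_neq0 //; lra.
rewrite ler_wpM2r //.
suff : n%:R / D%:R ^+ 2 <= 17 / 2200 :> R by lra.
by rewrite ler_pdivrMr ?exprn_gt0 //; [nra | lra].
Qed.
End Selection.

(** * Tseitin formulas at the midpoint *)

Section Tseitin.
Variables (R : realFieldType) (G : sgraph) (l : G -> bool).
Implicit Types (F K : {set edge G}) (Q : {set G}) (r : {ffun edge G -> bool}).
Implicit Types (h : ineq R (edge G)) (u v : G).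

Definition ends (e : edge G) : {set G} := val e.

Definition incident F v := star ends F v.

Lemma card_ends e : #|ends e| = 2%N.
Proof.
case: e => s; rewrite /ends /= => s_edge.
move: (s_edge); rewrite inE => /existsP[u /existsP[v /andP[uv /eqP->]]].
by rewrite cards2; case: eqP uv => [->|//]; rewrite adj_irr.
Qed.

Lemma parity_eq (r r' : {ffun edge G -> bool}) v :
  (forall e, v \in ends e -> r e = r' e) -> parity r v = parity r' v.
Proof. exact: eq_bigr. Qed.

Lemma midpoint_vertex_clause F r v a :
  midpoint F r (clause_ineq R (vertex_clause v a))
    = bound (clause_ineq R (vertex_clause v a)) - 1
    + \sum_(e | v \in ends e)
        `|(if e \in F then 2^-1 else (r e)%:R) - (a e)%:R|.
Proof.
have in_clause e b : ((e, b) \in vertex_clause v a) = (v \in ends e) && (b != a e).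
  apply/imsetP/andP => [[e' ve' [-> ->]]|[ve ne_b]].
    by rewrite inE in ve'; rewrite ve'; case: (a e').
  by exists e; rewrite ?inE //; case: b (a e) ne_b => [] [].
rewrite /midpoint /= [1 - _ - 1]addrAC subrr add0r -sum1_card natr_sum.
rewrite [\sum_(i in _) _]big_mkcond [\sum_(e | v \in _) _]big_mkcond /=.
rewrite -sumrN -big_split /=; apply: eq_bigr => e _.
rewrite !in_clause inE in_clause.
case: (v \in ends e) => /=; last by rewrite subrr mul0r oppr0 addr0.
case: ifP => _; last first.
  by case: (a e); case: (r e);
    rewrite /= ?subrr ?sub0r ?subr0 ?normrN ?normr1 ?normr0; lra.
have -> : `|2^-1 - (a e)%:R| = 2^-1 :> R.
  by case: (a e) => /=; [rewrite ler0_norm|rewrite ger0_norm]; lra.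
by case: (a e) => /=; lra.
Qed.

Lemma midpoint_input F r h :
  cnf_input (tseitin l) h ->
  (forall v, (2 <= #|incident F v|)%N
    \/ (forall e, v \in ends e -> e \notin F) /\ parity r v = l v) ->
  bound h <= midpoint F r h.
Proof.
move=> input_h vertexP.
have val01 e : 0 <= (if e \in F then 2^-1 else (r e)%:R : R) <= 1.
  by apply/andP; case: ifP => _; [|case: (r e)] => /=; split; lra.
case: input_h => [[C /bigcupP[v _ /imsetP[a]]]|[e eqh]]; last first.
  have /andP[val_ge0 val_le1] := val01 e.
  by case: eqh => ->; rewrite /midpoint (bigD1 e) //= eqxx big1
    => [|f /negPf->] /=; rewrite ?oppr0 ?mul0r ?addr0 ?mul1r ?mulN1r ?lerN2.
rewrite inE => parity_a -> ->; rewrite midpoint_vertex_clause.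
rewrite -addrA lerDl addrC subr_ge0.
have [/card_gt1P[e [f [eF fF ne_ef]]]|[fixed parity_r]] := vertexP v.
  move: eF fF; rewrite !inE => /andP[eF ve] /andP[fF vf].
  rewrite (bigD1 e) //= (bigD1 f) /=; last by rewrite vf eq_sym.
  rewrite eF fF.
  have term (b : bool) : `|2^-1 - b%:R| = 2^-1 :> R.
    by case: b => /=; [rewrite ler0_norm|rewrite ger0_norm]; lra.
  rewrite !term addrA ler_wpDr ?sumr_ge0 //; lra.
have [e ve ne_ra] : exists2 e, v \in ends e & r e != a e.
  apply/exists_inP; apply: contraNT parity_a => /exists_inPn eq_ra.
  rewrite -parity_r; apply/eqP; apply: parity_eq => e ve.
  by apply/esym/eqP; rewrite -[_ == _]negbK eq_ra.
rewrite (bigD1 e) //= (negPf (fixed _ ve)) ler_wpDr ?sumr_ge0 //.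
by case: (r e) (a e) ne_ra => [] [] //= _; rewrite ?subr0 ?sub0r ?normrN normr1.
Qed.

Definition live K Q : {set edge G} := [set e | (e \notin K) && [disjoint ends e & Q]].

Definition settled K Q r (t : nat) : Prop :=
  forall v, v \in Q -> (t <= #|incident K v|)%N /\ parity r v = l v.

Lemma live_disjoint K Q e v : e \in live K Q -> v \in Q -> v \notin ends e.
Proof.
by rewrite inE => /andP[_ dis] vQ; rewrite (disjointFl dis vQ).
Qed.

Lemma live_setU1 K Q v : live K (v |: Q) = live K Q :\: incident (live K Q) v.
Proof.
have dis e : [disjoint ends e & v |: Q] = (v \notin ends e) && [disjoint ends e & Q].
  rewrite disjoint_sym [X in _ && X]disjoint_sym -disjointU1.
  by apply: eq_disjoint => u; rewrite !inE.
apply/setP => e; rewrite !inE dis.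
by case: (e \in K); case: [disjoint _ & _]; rewrite ?andbF ?andbT.
Qed.

Lemma settle K Q r h (t : nat) :
  (forall Q' v, Q \subset Q' -> (forall u, u \in Q' -> (t <= #|incident K u|)%N) ->
     v \notin Q' -> (2 <= #|incident (live K Q') v|)%N) ->
  settled K Q r t -> midpoint (live K Q) r h < bound h ->
  exists Q' r', [/\ settled K Q' r' t, midpoint (live K Q') r' h < bound h &
    forall v, v \notin Q' -> (#|incident K v| < t)%N].
Proof.
have [m] := ubnP #|~: Q|; elim: m => // m IHm in Q r * => ltm two_live settledQ mid.
have [/exists_inP[v vQ heavy]|] := boolP [exists v in ~: Q, t <= #|incident K v|]%N;
  last first.
  move=> /exists_inPn light; exists Q, r; split=> // v vQ.
  by rewrite ltnNge light ?inE.
rewrite inE in vQ.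
have degQ u : u \in Q -> (t <= #|incident K u|)%N by case/settledQ.
have [||r' [eq_r parity_r' le_mid]] := midpoint_set_parity (F := live K Q)
    (S := incident (live K Q) v) (A := [set e | v \in ends e]) r h (l v) _ _
    (two_live _ _ (subxx _) degQ vQ).
- by apply/subsetP => e; rewrite inE => /andP[].
- by apply/subsetP => e; rewrite !inE => /andP[].
apply: (IHm (v |: Q) r').
- rewrite -ltnS (leq_trans _ ltm) // ltnS [X in (_ < X)%N](cardsD1 v) inE vQ add1n ltnS.
  by apply: subset_leq_card; apply/subsetP => u; rewrite !inE negb_or.
- move=> Q' u; rewrite subUset => /andP[_ sQQ']; exact: two_live.
- move=> u; rewrite in_setU1 => /orP[/eqP->|uQ].
    split=> //; rewrite -parity_r' /parity.
    by apply: eq_bigl => e; rewrite inE.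
  have [degu <-] := settledQ u uQ; split=> //.
  apply: parity_eq => e ue; apply: eq_r; rewrite inE negb_and.
  by apply/orP; left; apply: contraL ue => /live_disjoint; apply.
by rewrite live_setU1; apply: le_lt_trans le_mid mid.
Qed.
End Tseitin.

(** * The depth lower bound on complete graphs *)

Lemma path_depth (R : realFieldType) (X : finType) (F : cnf X)
    (P : scp_proof R F) (j : 'I_(plength P)) (p : seq 'I_(plength P)) :
  path (fun i i' => i \in prem i') j p -> (size p <= depth P)%N.
Proof.
move=> path_p.
have : path ltn (val j) (map val p).
  apply: (homo_path (e := fun i i' => i \in prem i')) path_p => i i'.
  exact: prem_earlier.
move=> /(sorted_uniq ltn_trans ltnn (s := val j :: map val p)).
rewrite -map_cons => /map_uniq/card_uniqP/= size_p.
have lt_size : (size p < plength P)%N.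
  by rewrite -{2}(card_ord (plength P)) -ltnS -size_p ltnS max_card.
apply: (leq_bigmax_cond (F := @nat_of_ord (plength P)) (Ordinal lt_size)).
by apply/existsP; exists j; apply/existsP; exists (in_tuple p).
Qed.

Section CompleteGraph.
Variable n : nat.

Lemma complete_sym : symmetric (fun u v : 'I_n => u != v).
Proof. by move=> u v; rewrite eq_sym. Qed.

Lemma complete_irr : irreflexive (fun u v : 'I_n => u != v).
Proof. by move=> u; rewrite eqxx. Qed.

Definition complete : sgraph := SGraph complete_sym complete_irr.

Implicit Types (K : {set edge complete}) (Q : {set complete}) (u v : complete).

Lemma edge_complete u v : u != v -> [set u; v] \in edges complete.
Proof.
move=> ne_uv; rewrite inE; apply/existsP; exists u; apply/existsP; exists v.
by rewrite eqxx andbT.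
Qed.

Lemma ends_other e v : v \in @ends complete e -> exists u, ends e = [set u; v].
Proof.
have /eqP/cards2P[a [b [_ ->]]] := card_ends e.
by rewrite !inE => /orP[]/eqP->; [exists b; rewrite setUC|exists a].
Qed.

Lemma degree_complete v : (#|incident [set: edge complete] v| <= n)%N.
Proof.
rewrite -[n in (_ <= n)%N]card_ord -(card_imset _ val_inj).
apply: leq_trans (leq_imset_card (fun u => [set u; v]) _).
apply: subset_leq_card; apply/subsetP => _ /imsetP[e ve ->].
have [|u eq_e] := @ends_other e v; first by rewrite inE in ve; case/andP: ve.
by apply/imsetP; exists u.
Qed.

Lemma card_edge_complete : (#|{: edge complete}| <= n * n)%N.
Proof.
rewrite -[n in (_ <= n * n)%N]card_ord -card_prod -cardsT -(card_imset _ val_inj).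
apply: leq_trans (leq_imset_card (fun uv => [set uv.1; uv.2]) _).
apply: subset_leq_card; apply/subsetP => _ /imsetP[e _ ->].
have /eqP/cards2P[a [b [_ eq_e]]] := card_ends e.
by apply/imsetP; exists (a, b).
Qed.

Lemma live_degree K Q v : v \notin Q ->
  (n <= 1 + #|Q| + #|incident K v| + #|incident (live K Q) v|)%N.
Proof.
move=> vQ; set A := ~: (v |: Q).
have cardA : (1 + #|Q| + #|A| = n)%N.
  by have := cardsC (v |: Q); rewrite -/A cardsU1 vQ card_ord add1n.
have : (#|A| <= #|incident K v :|: incident (live K Q) v|)%N.
  rewrite -(card_imset _ val_inj).
  rewrite -(card_in_imset (f := fun u => [set u; v]) (D := A)) => [|u u']; last first.
    rewrite !inE !negb_or => /andP[ne_uv _] _ /setP/(_ u).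
    by rewrite !inE eqxx (negPf ne_uv) !orbF => /esym/eqP.
  apply: subset_leq_card; apply/subsetP => _ /imsetP[u uA ->].
  have /andP[ne_uv uQ] : (u != v) && (u \notin Q) by rewrite -negb_or -in_setU1 -in_setC.
  apply/imsetP; exists (Sub [set u; v] (edge_complete ne_uv)) => //.
  rewrite !inE /ends /= eqxx orbT !andbT.
  case: (_ \in K) => //=; rewrite disjoint_sym disjoints_subset.
  apply/subsetP => w wQ; rewrite !inE negb_or.
  by apply/andP; split; apply: contraTneq wQ => ->.
by have := cardsU (incident K v) (incident (live K Q) v); lia.
Qed.

Lemma sum_degree K : (\sum_v #|incident K v| = 2 * #|K|)%N.
Proof.
under eq_bigr do rewrite -sum1_card.
rewrite (exchange_big_dep (mem K)) /= => [|v e _]; last by rewrite inE => /andP[].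
rewrite mulnC -sum_nat_const; apply: eq_bigr => e eK.
by rewrite -(@card_ends complete e) -sum1_card; apply: eq_bigl => v; rewrite inE eK.
Qed.

Lemma card_heavy K Q (t : nat) :
  (forall v, v \in Q -> (t <= #|incident K v|)%N) -> (#|Q| * t <= 2 * #|K|)%N.
Proof.
move=> heavy; rewrite -sum_degree -sum_nat_const.
rewrite [X in (_ <= X)%N](bigID (mem Q)) /= -[X in (X <= _)%N]addn0.
by apply: leq_add => //; apply: leq_sum.
Qed.

Lemma incidentU K K' v :
  (#|incident (K :|: K') v| <= #|incident K v| + #|incident K' v|)%N.
Proof.
rewrite -cardsUI (leq_trans _ (leq_addr _ _)) //.
by apply: subset_leq_card; apply/subsetP => e; rewrite !inE andb_orl.
Qed.

Variables (R : realFieldType) (l : complete -> bool) (D : nat).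
Hypotheses (D_ge : (2200 <= D)%N) (ge_n : (16 * D <= n)%N) (le_n : (n <= 17 * D)%N).

(* K consists of the edges assigned for being heavy and Q of the removed
   vertices; each of these has 2 D edges in K, which bounds their number. *)
Definition reached (s : nat) (h : ineq R (edge complete)) : Prop :=
  exists K Q r, [/\ (#|K| <= 16 * n * s)%N, settled l K Q r (2 * D),
    forall v, v \notin Q -> (#|incident K v| < 2 * D)%N &
    midpoint (live K Q) r h < bound h].

Lemma two_live (s : nat) K Q v : (68 * s <= D)%N -> (#|K| <= 16 * n * s)%N ->
  (forall u, u \in Q -> (2 * D <= #|incident K u|)%N) -> v \notin Q ->
  (#|incident K v| <= 4 * D)%N -> (2 <= #|incident (live K Q) v|)%N.
Proof.
move=> le_s le_K heavy vQ le_v; have := live_degree K vQ.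
have le_Q : (#|Q| <= 4 * D)%N.
  have := card_heavy heavy; nia.
lia.
Qed.

Lemma reached_premise (s : nat) (P : scp_proof R (tseitin l)) i :
  (68 * s.+1 <= D)%N -> reached s (line (s := P) i) ->
  exists2 j, j \in prem i & reached s.+1 (line (s := P) j).
Proof.
move=> le_s [K [Q [r [leK settledQ light mid]]]]; set h := line i in mid.
have [[_ input_h]|implied] := line_valid (s := P) i.
  suff : bound h <= midpoint (live K Q) r h by rewrite leNgt mid.
  apply: (midpoint_input input_h) => v.
  have [vQ|vQ] := boolP (v \in Q).
    right; split; last by case: (settledQ v vQ).
    by move=> e; apply: contraTN => /live_disjoint; apply.
  left; apply: (@two_live s) => //; [lia| |by have := light v vQ; lia].
  by move=> u /settledQ[].
have [j j_prem falsified_j] : exists2 j, j \in prem i &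
    (cube_size (edge complete) <= 4 * #|falsified (live K Q) r (line (s := P) j)|)%N.
  apply/exists_inP; rewrite -[X in is_true X]negbK; apply/negP => /exists_inPn small.
  have le_cube := midpoint_falsified mid.
  have cube_gt0 : (0 < cube_size (edge complete))%N.
    by apply/card_gt0P; exists [ffun=> false].
  have : (#|falsified (live K Q) r h|
      <= \sum_(j in prem i) #|falsified (live K Q) r (line (s := P) j)|)%N.
    apply: leq_trans (_ : #|\bigcup_(j in prem i)
        falsified (live K Q) r (line (s := P) j)| <= _)%N.
      apply: subset_leq_card; apply/subsetP => x; rewrite inE => false_x.
      have [j j_prem false_j] : exists2 j, j \in prem i &
          ~~ holds (overlay (live K Q) r x) (line (s := P) j).
        apply/exists_inP; apply: contraNT false_x => /exists_inPn true_x.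
        by apply: implied => j /true_x; rewrite negbK.
      by apply/bigcupP; exists j; rewrite ?inE.
    apply: (big_ind2 (fun (A : {set _}) m => #|A| <= m)%N) => [|A a B b leA leB|//].
      by rewrite cards0.
    by apply: leq_trans (leq_card_setU A B) _; apply: leq_add.
  have : (4 * \sum_(j in prem i) #|falsified (live K Q) r (line (s := P) j)|
      <= #|prem i| * (cube_size (edge complete)).-1)%N.
    rewrite -sum_nat_const big_distrr; apply: leq_sum => j /small /=.
    by rewrite -ltnNge; lia.
  have := prem_le2 (s := P) i; nia.
exists j => //; set g := line j in falsified_j *.
have w_ge0 e : 0 <= `|coef g e| by [].
have n_gt0 : (0 < n)%N by lia.
have sqr_abs (A : {set edge complete}) :
    \sum_(e in A) coef g e ^+ 2 = \sum_(e in A) `|coef g e| ^+ 2.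
  by apply: eq_bigr => e _; rewrite real_normK ?num_real.
have [T1 [sT1 leT1 degT1 l2T1]] := select_l2 w_ge0 (@card_ends complete)
  degree_complete card_edge_complete (live K Q) D_ge n_gt0 le_n.
have [T2 [sT2 leT2 degT2 l2T2]] := select_l2 w_ge0 (@card_ends complete)
  degree_complete card_edge_complete (live K Q :\: T1) D_ge n_gt0 le_n.
rewrite -sqr_abs in l2T1; rewrite -sqr_abs in l2T2.
have mid_g := boost2 sT1 sT2 l2T1 l2T2 falsified_j.
set r' := minimize T2 g _ in mid_g.
pose K' := K :|: T1 :|: T2.
have live_K' : live K Q :\: T1 :\: T2 = live K' Q.
  apply/setP => e; rewrite !inE !negb_or.
  by case: (e \in T2); case: (e \in T1); case: (e \in K).
have le_K' : (#|K'| <= 16 * n * s.+1)%N.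
  apply: leq_trans (leq_card_setU _ _) _.
  apply: leq_trans (leq_add (leq_card_setU _ _) leT2) _.
  apply: leq_trans (leq_add (leq_add leK leT1) (leqnn _)) _.
  by rewrite mulnS; clear; lia.
have sub_K' v : (#|incident K v| <= #|incident K' v|)%N.
  by apply: subset_leq_card; apply/subsetP => e; rewrite !inE => /andP[-> ->].
rewrite live_K' in mid_g.
have [||Q' [r'' [settledQ' mid' light']]] := settle (t := 2 * D) _ _ mid_g (l := l).
- move=> Q' v sQQ' heavy vQ'; apply: (@two_live s.+1) => //.
  have lt_v := light v (contra (subsetP sQQ' v) vQ').
  apply: leq_trans (incidentU _ _ _) _.
  apply: leq_trans (leq_add (incidentU _ _ _) (degT2 v)) _.
  apply: leq_trans (leq_add (leq_add (ltnW lt_v) (degT1 v)) (leqnn D)) _.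
  by clear; lia.
- move=> v vQ; have [deg_v <-] := settledQ v vQ; split; first exact: leq_trans deg_v _.
  apply: parity_eq => e ve; rewrite !ffunE.
  have eF : e \notin live K Q by apply: contraTN ve => /live_disjoint; apply.
  rewrite (negPf (contra (subsetP sT1 e) eF)).
  suff /negPf-> : e \notin T2 by [].
  by apply: contra eF => /(subsetP sT2); rewrite inE => /andP[].
by exists K', Q', r''.
Qed.

Lemma depth_complete (P : scp_proof R (tseitin l)) (s : nat) :
  refutation P -> (68 * s <= D)%N -> (s <= depth P)%N.
Proof.
move=> [i0 unsat] le_s.
suff [j [p [size_p path_p _]]] : exists j p, [/\ size p = s,
    path (fun i i' : 'I_(plength P) => i \in prem i') j p & reached s (line j)].
  by rewrite -size_p (path_depth path_p).
elim: s le_s => [|s IHs] le_s.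
  exists i0, [::]; split=> //; exists set0, set0, [ffun=> false].
  have inc0 v : incident (set0 : {set edge complete}) v = set0.
    by apply/setP => e; rewrite !inE.
  split=> [|v|v _|]; rewrite ?inE ?inc0 ?cards0 //; first lia.
  apply: falsified_midpoint.
  rewrite (_ : falsified _ _ _ = setT); last by apply/setP => x; rewrite !inE unsat.
  by rewrite cardsT ltn_Pmull //; apply/card_gt0P; exists [ffun=> false].
have [|j [p [size_p path_p reached_j]]] := IHs; first lia.
have [k k_prem reached_k] := reached_premise le_s reached_j.
by exists k, (j :: p); rewrite /= size_p k_prem.
Qed.
End CompleteGraph.

(** * Existence of refutations *)

Lemma binary_inj m (a b : nat -> bool) :
  (\sum_(i < m) a i * 2 ^ i = \sum_(i < m) b i * 2 ^ i)%N ->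
  forall i, (i < m)%N -> a i = b i.
Proof.
elim: m => // m IHm in a b *; rewrite !big_ord_recl !expn0 !muln1.
have shift (c : nat -> bool) : (\sum_(i < m) c (lift ord0 i) * 2 ^ lift ord0 i
    = 2 * \sum_(i < m) c i.+1 * 2 ^ i)%N.
  by rewrite big_distrr; apply: eq_bigr => i _; rewrite lift0 expnS mulnCA.
rewrite !shift => eq_ab.
have eq0 : a 0%N = b 0%N by move: (a 0%N) (b 0%N) eq_ab => [] []; lia.
case=> [//|i lt_im]; apply: (IHm (fun j => a j.+1) (fun j => b j.+1)) => //.
by move/eqP: eq_ab; rewrite eq0 eqn_add2l eqn_pmul2l // => /eqP.
Qed.

Section Refutation.
Variables (R : realFieldType) (X : finType) (F : cnf X).

Definition code (a : {ffun X -> bool}) : nat :=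
  \sum_x a x * 2 ^ enum_rank x.

Lemma code_inj : injective code.
Proof.
pose bit (c : {ffun X -> bool}) (i : nat) :=
  if insub i is Some j then c (enum_val (j : 'I_#|X|)) else false.
have code_bits c : code c = (\sum_(i < #|X|) bit c i * 2 ^ i)%N.
  rewrite /code (reindex _ (onW_bij _ (@enum_val_bij X))) /=.
  by apply: eq_bigr => i _; rewrite /bit valK enum_valK.
move=> a b; rewrite !code_bits => eq_ab; apply/ffunP => x.
have := binary_inj eq_ab (ltn_ord (enum_rank x)).
by rewrite /bit valK enum_rankK.
Qed.

Definition code_ge (k : nat) : ineq R X :=
  Ineq (fun x => (2 ^ enum_rank x)%:R) k%:R.

Lemma holds_code_ge a k : holds a (code_ge k) = (k <= code a)%N.
Proof.
rewrite /holds /= -(ler_nat R) natr_sum; congr (_ <= _).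
by apply: eq_bigr => x _; rewrite -natrM mulnC.
Qed.

Variable C : {ffun X -> bool} -> clause X.
Hypothesis C_in : forall a, C a \in F.
Hypothesis C_falsified : forall a, ~~ holds a (clause_ineq R (C a)).

Definition code_bound : nat := (\max_a code a).+1.

(* Line 2k says that the code is at least k; line 2k + 1 rules out the only
   assignment with code k. *)
Definition chain_line (i : 'I_(code_bound.*2.+1)) : ineq R X :=
  if odd i then
    if [pick a | code a == i./2] is Some a then clause_ineq R (C a)
    else code_ge 0
  else code_ge i./2.

Definition chain_prem (i : 'I_(code_bound.*2.+1)) : {set 'I_(code_bound.*2.+1)} :=
  [set j : 'I__ | [&& ~~ odd i, j < i & i <= j.+2]%N].

Lemma chain_earlier i j : j \in chain_prem i -> (j < i)%N.
Proof. by rewrite inE => /and3P[]. Qed.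

Lemma chain_le2 i : (#|chain_prem i| <= 2)%N.
Proof.
rewrite cardE -(size_map val) (uniq_leq_size (s2 := [:: i.-1; i.-2])) //.
  by rewrite map_inj_uniq ?enum_uniq //; apply: val_inj.
move=> _ /mapP[j + ->]; rewrite mem_enum !inE => /and3P[_ ? ?].
by rewrite -[val j]/(nat_of_ord j); lia.
Qed.

Lemma chain_valid i :
  (chain_prem i = set0 /\ cnf_input F (chain_line i))
  \/ (forall a : {ffun X -> bool},
        (forall j, j \in chain_prem i -> holds a (chain_line j)) ->
        holds a (chain_line i)).
Proof.
have [odd_i|even_i] := boolP (odd i).
  rewrite /chain_line odd_i; case: pickP => [a _|_]; [left; split|right=> a _].
  - by apply/setP => j; rewrite !inE odd_i.
  - by left; exists (C a).
  - by rewrite holds_code_ge.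
right=> a holds_prem; rewrite /chain_line (negPf even_i) holds_code_ge.
case def_k: i./2 => [//|k].
have def_i : nat_of_ord i = k.*2.+2 by rewrite -(odd_double_half i) (negPf even_i) def_k.
have lt_i := ltn_ord i; rewrite def_i in lt_i.
have lt0 : (k.*2 < code_bound.*2.+1)%N by lia.
have lt1 : (k.*2.+1 < code_bound.*2.+1)%N by lia.
have prem0 : Ordinal lt0 \in chain_prem i by rewrite inE even_i def_i /=; lia.
have prem1 : Ordinal lt1 \in chain_prem i by rewrite inE even_i def_i /=; lia.
have := holds_prem _ prem1; have := holds_prem _ prem0.
rewrite /chain_line /= odd_double doubleK /= holds_code_ge uphalf_double => le_k h1.
rewrite ltn_neqAle le_k andbT; apply/eqP => eq_k.
move: h1; case: pickP => [b /eqP eq_b|/(_ a)]; last by rewrite eq_k eqxx.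
have -> : b = a by apply: code_inj; rewrite eq_b.
by rewrite (negPf (C_falsified a)).
Qed.

Lemma chain_refutation : exists P : scp_proof R F, refutation P.
Proof.
exists (ScpProof chain_earlier chain_le2 chain_valid), ord_max => a /=.
rewrite /chain_line /= odd_double doubleK holds_code_ge -ltnNge ltnS.
exact: leq_bigmax.
Qed.
End Refutation.

Lemma refutation_depth_exists (R : realFieldType) (X : finType) (F : cnf X) :
  (exists P : scp_proof R F, refutation P) -> exists d, is_refutation_depth R F d.
Proof.
case=> P refP.
pose attained d := `[< exists2 P : scp_proof R F, refutation P & depth P = d >].
have [|d /asboolP attained_d min_d] := @ex_minnP attained.
  by exists (depth P); apply/asboolP; exists P.
exists d; split=> // Q refQ; apply: min_d.
by apply/asboolP; exists Q.
Qed.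

Section TseitinRefutation.
Variables (R : realFieldType) (G : sgraph) (l : G -> bool).

Lemma sum_parity (a : {ffun edge G -> bool}) :
  \big[addb/false]_(v : G) parity a v = false.
Proof.
rewrite (exchange_big_dep xpredT) //=; apply: big1 => e _.
have /eqP/cards2P[u [v [ne_uv eq_e]]] := card_ends e.
rewrite /ends in eq_e; rewrite eq_e big_setU1 ?inE //= big_set1.
exact: addbb.
Qed.

Lemma vertex_clause_falsified (a : {ffun edge G -> bool}) v :
  ~~ holds a (clause_ineq R (vertex_clause v a)).
Proof.
have := midpoint_vertex_clause R set0 a v a.
rewrite big1 => [|e _]; last by rewrite inE subrr normr0.
rewrite /holds -ltNge addr0 /midpoint.
under eq_bigr do rewrite inE; move=> ->.
by rewrite gtrBl.
Qed.

Lemma tseitin_refutable :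
  \big[addb/false]_v l v = true ->
  exists P : scp_proof R (tseitin l), refutation P.
Proof.
move=> odd_l.
have violated (a : {ffun edge G -> bool}) : exists v, parity a v != l v.
  apply/existsP; apply: contraT => /existsPn eq_l.
  have := sum_parity a; rewrite (eq_bigr l) ?odd_l // => v _.
  by apply/eqP; rewrite -[_ == _]negbK eq_l.
pose vertex_of a := xchoose (violated a).
apply: (@chain_refutation _ _ _ (fun a => vertex_clause (vertex_of a) a)) => a.
  apply/bigcupP; exists (vertex_of a) => //; apply/imsetP; exists a => //.
  by rewrite inE; apply: xchooseP (violated a).
exact: vertex_clause_falsified.
Qed.
End TseitinRefutation.

Theorem theorem1p5 (R : realType) :
  exists2 c : R, 0 < c &
  exists n0 : nat, forall n : nat, (n0 <= n)%N ->
  exists (G : sgraph) (l : G -> bool) (d : nat),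
    [/\ #|G| = n, is_refutation_depth R (tseitin l) d & c * n%:R <= d%:R].
Proof.
exists (2000%:R)^-1; first by rewrite invr_gt0 ltr0n.
exists (16 * 2200)%N => n le_n.
have n_gt0 : (0 < n)%N by lia.
pose l := fun v : complete n => v == Ordinal n_gt0 :> 'I_n.
have odd_l : \big[addb/false]_v l v = true.
  by rewrite (bigD1 (Ordinal n_gt0)) //= big1 /l ?eqxx // => v /negPf.
have [d min_d] := refutation_depth_exists (tseitin_refutable R odd_l).
exists (complete n), l, d; split=> //; first exact: card_ord.
have [[P refP eq_d] _] := min_d.
pose D := (n %/ 16)%N.
have D_ge : (2200 <= D)%N by rewrite /D; lia.
have := @depth_complete n R l D D_ge _ _ P (D %/ 68)%N refP.
rewrite eq_d => /(_ _ _ _) le_d.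
have {}le_d : (D %/ 68 <= d)%N by apply: le_d; rewrite /D; lia.
rewrite ler_pdivrMl ?ltr0n // -natrM ler_nat.
by rewrite /D in le_d D_ge; lia.
Qed.
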